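(* Let $p$ be an odd prime. A graph $G$ with $V$ vertices and $E$ edges has at most $$C_{V,E}=\frac{(V-1)^{p-1}-1}{V^{p/2}(V-1)^{p/2-1}}\cdot\frac{2^{p/2-1}}{p}\,E^{p/2}$$ $p$-cycles, where equality holds if and only if $G$ is the complete graph on $V$ vertices.
   Context: Graphs are finite, simple, loopless and undirected. For an odd prime $p$, a $p$-cycle of $G$ means a closed path of length $p$ in $G$, i.e. a cyclic sequence of vertices $(v_0,v_1,\dots,v_{p-1})$ with $v_i$ adjacent to $v_{i+1}$ for all $i$ (indices mod $p$), where repeated vertices and edges are allowed and two sequences are identified if they differ by a choice of starting point and/or orientation. Equivalently, the number of $p$-cycles is $\frac{1}{2p}\,\mathrm{tr}(A^p)$, where $A$ is the adjacency matrix of $G$.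
   Formalization: The equality characterization is stated only for graphs with at least one edge, since an edgeless graph on V ≥ 2 vertices has 0 p-cycles and C_{V,0} = 0, so equality holds although it is not complete; the upper bound is for all graphs. *)

(* Defs.v *)
From mathcomp Require Import all_boot all_order all_algebra.
From mathcomp Require Import reals exp.

Set Implicit Arguments.
Unset Strict Implicit.
Unset Printing Implicit Defensive.

Import Order.TTheory GRing.Theory Num.Theory.

(* A graph is a symmetric irreflexive relation e on a finite vertex type. *)

Section Graph.
Variables (T : finType) (e : rel T).

Definition edges : {set {set T}} :=
  [set [set u.1; u.2] | u : T * T & e u.1 u.2].

Definition complete : Prop := forall x y : T, x != y -> e x y.

(* [cycle e w] includes the edge from the last vertex back to the first and
   allows repetitions. *)
Definition closed_walks (p : nat) : {set p.-tuple T} :=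
  [set w : p.-tuple T | cycle e w].

End Graph.

Definition same_cycle (T : finType) (p : nat) : rel (p.-tuple T) :=
  fun w w' => [exists i : 'I_p,
    (w' == rot i w :> seq T) || (w' == rot i (rev w) :> seq T)].

Definition num_cycles (T : finType) (e : rel T) (p : nat) : nat :=
  #|equivalence_partition (@same_cycle T p) (closed_walks e p)|.

(* [equivalence_partition] is a partition into classes only for an equivalence
   relation; for p = 0 the relation [same_cycle] is empty. *)
Lemma same_cycle_equiv (T : finType) (p : nat) :
  0 < p -> equivalence_rel (@same_cycle T p).
Proof.
move=> p_gt0.
have P (w w' : p.-tuple T) : reflect
    (exists i, (w' = rot i w :> seq T) \/ (w' = rot i (rev w) :> seq T))
    (same_cycle w w').
  apply: (iffP existsP) => [[i /orP[] /eqP h]|[i h]].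
  - by exists i; left.
  - by exists i; right.
  have rotlt (s : seq T) : size s = p -> exists j : 'I_p, rot i s = rot j s.
    move=> ss; case: (ltnP i p) => [ip|pi]; first by exists (Ordinal ip).
    by exists (Ordinal p_gt0); rewrite rot0 rot_oversize ?ss.
  case: h => h.
    have [j hj] := rotlt w (size_tuple w).
    by exists j; rewrite h hj eqxx.
  have [j hj] := rotlt (rev w) (etrans (size_rev w) (size_tuple w)).
  by exists j; rewrite h hj eqxx orbT.
have rr (s : seq T) i j : exists k, rot i (rot j s) = rot k s.
  have [si|si] := leqP i (size s); have [sj|sj] := leqP j (size s).
  - by rewrite rot_add_mod //; case: ifP => _; eexists.
  - by rewrite (rot_oversize (ltnW sj)); exists i.
  - by rewrite (@rot_oversize _ i) ?size_rot 1?ltnW //; exists j.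
  - by rewrite (@rot_oversize _ i) ?size_rot 1?ltnW //; exists j.
have rv (s : seq T) i : exists k, rev (rot i s) = rot k (rev s).
  by rewrite rev_rot /rotr; eexists.
have refl (w : p.-tuple T) : same_cycle w w.
  by apply/P; exists 0; left; rewrite rot0.
have sym (w w' : p.-tuple T) : same_cycle w w' -> same_cycle w' w.
  case/P=> i [] h; apply/P.
    by rewrite h; exists (size (rot i w) - i); left; rewrite -[LHS](rotK i).
  exists i; right.
  by rewrite h rev_rot revK rotrK.
have tr (w w' w'' : p.-tuple T) :
    same_cycle w w' -> same_cycle w' w'' -> same_cycle w w''.
  case/P=> i hi /P[j hj]; apply/P.
  case: hi => hi; case: hj => ->; rewrite hi.
  - by have [k ->] := rr w j i; exists k; left.
  - have [k ->] := rv w i; have [l ->] := rr (rev w) j k.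
    by exists l; right.
  - by have [k ->] := rr (rev w) j i; exists k; right.
  - have [k ->] := rv (rev w) i; rewrite revK; have [l ->] := rr w j k.
    by exists l; left.
move=> x y z; split=> // xy; apply/idP/idP => h; last exact: tr h.
exact: tr (sym _ _ xy) h.
Qed.

Local Open Scope ring_scope.

(* For V <= 1 the quotient is degenerate; then E = 0 and the last factor makes
   the value 0. *)
Definition cycle_bound (R : realType) (p V E : nat) : R :=
  ((V%:R - 1) ^+ (p - 1) - 1)
    / (V%:R `^ (p%:R / 2) * (V%:R - 1) `^ (p%:R / 2 - 1))
  * (2 `^ (p%:R / 2 - 1) / p%:R) * E%:R `^ (p%:R / 2).

(* Main.v *)
Require Import Defs.
From mathcomp Require Import all_boot all_order all_algebra.
From mathcomp Require Import sesquilinear spectral polyrcf complex.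
From mathcomp Require Import reals exp.
From mathcomp Require Import zify ring lra.

Import Order.TTheory GRing.Theory Num.Theory.

(** The number of closed walks of length p is the trace of A ^+ p, the sum of
    the p-th powers of the eigenvalues r_i of the adjacency matrix A, and the
    dihedral group of order 2p acts freely on these walks because p is an odd
    prime ([card_closed_walks], [trace_adjmx], [real_symmetric_spectrum]).  So
    the theorem is about the largest value of the sum of the r_i ^+ p when the
    sum of the r_i is \tr A = 0 and the sum of their squares is
    \tr (A ^+ 2) = 2 * E.

    Write V = m + 1 and 2 * E = s ^+ 2 * m * (m + 1).  The claim is that the
    maximum is attained at the multiple (s * m, - s, ..., - s) of the spectrum
    of the complete graph.  Scale to s = 1.  By Cauchy-Schwarz all the r_i are
    then at most m.  Expanding at -1 gives, for odd p,
      x ^+ p = p * (x + 1) - 1 - (x + 1) ^+ 2 * Q(- x),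
    where Q is the quotient of u ^+ p - 1 - p * (u - 1) by (u - 1) ^+ 2.  This
    polynomial is strictly increasing ([taylor2_lt]), so Q(- x) >= Q(- m) for
    x <= m.  Replacing Q(- r_i) by Q(- m) bounds the sum of the r_i ^+ p by an
    expression in the first two power sums only, and both of these are the same
    for (m, -1, ..., -1), where nothing is lost ([power_sum_normalized]).

    In case of equality each r_i is -1 or m, and the vanishing of their sum
    leaves exactly one m.  Undoing the scaling, A + s has rank one, so
    its 2 x 2 minors vanish; as A has zero diagonal, A i j * A j i = s ^+ 2
    is nonzero for i != j, and the graph is complete.  Conversely the spectrum
    of the complete graph attains the maximum, which here is the recurrence
    A ^+ 2 = (m - 1) A + m satisfied by its adjacency matrix
    ([trace_adjmx_complete]). *)

(** * Closed walks up to the dihedral action *)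

Lemma nth_rot_mod (T : Type) (x0 : T) (s : seq T) (i k : nat) :
  i <= size s -> k < size s ->
  nth x0 (rot i s) k = nth x0 s ((k + i) %% size s).
Proof.
move=> is_ ks; rewrite /rot nth_cat size_drop nth_drop addnC.
case: ltnP => h; first by rewrite modn_small //; lia.
have -> : k + i = k - (size s - i) + size s by lia.
by rewrite nth_take ?modnDr ?modn_small //; lia.
Qed.

Section CyclicIndexing.
Variables (T : finType) (e : rel T) (p : nat) (w : p.-tuple T) (x0 : T).
Hypotheses (irr_e : irreflexive e) (cyc : cycle e w).

Let g k := nth x0 w (k %% p).

Lemma cycle_step k : 0 < p -> g k != g k.+1.
Proof.
move=> p0; apply/eqP => eq; suff : e (g k) (g k.+1) by rewrite eq irr_e.
have kp : k %% p < p by rewrite ltn_mod.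
have E : g k.+1 = nth x0 (rot 1 w) (k %% p).
  by rewrite nth_rot_mod size_tuple // modnDml addn1.
rewrite {}E /g {eq}; move: (k %% p) kp => a ap {k}.
have := cyc; have := size_tuple w; case: (tval w) => [|x s] /=.
  by move=> h; move: ap; rewrite -h.
move=> sp /(pathP x0) /(_ a); rewrite size_rcons sp => /(_ ap).
rewrite rot1_cons; case: a ap => //= a; rewrite -sp ltnS => ap.
by rewrite [nth x0 (rcons _ _) a]nth_rcons ap.
Qed.

Lemma rot_eq_shift (i j : nat) k : i < p -> j < p ->
  rot i w = rot j w -> g (k + i) = g (k + j).
Proof.
move=> ip jp eq; rewrite /g -modnDml -[in RHS]modnDml.
have kp : k %% p < p by rewrite ltn_mod; lia.
have := congr1 (fun s => nth x0 s (k %% p)) eq.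
by rewrite !nth_rot_mod ?size_tuple // ltnW.
Qed.

(** If rotations by i < j agreed, the walk would have period j - i; being prime
    to p, this has an inverse modulo p, so the walk would be constant. *)
Lemma rot_neq (i j : 'I_p) : prime p -> i != j -> rot i w != rot j w :> seq T.
Proof.
move=> pp.
wlog lt : i j / i < j.
  move=> H ne; have [lt|lt|eq] := ltngtP i j; first exact: H.
    by rewrite eq_sym H // eq_sym.
  by move: ne; rewrite (ord_inj eq) eqxx.
move=> _; apply/eqP => eq; have p0 := prime_gt0 pp.
have gp k : g (k + p) = g k by rewrite /g modnDr.
have gd k : g k = g (k + (j - i)).
  have := rot_eq_shift _ _ (k + (p - i)) (ltn_ord i) (ltn_ord j) eq.
  have -> : k + (p - i) + i = k + p by have := ltn_ord i; lia.
  have -> : k + (p - i) + j = k + (j - i) + p by have := ltn_ord i; lia.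
  by rewrite !gp.
have gt t k : g k = g (k + t * (j - i)).
  elim: t k => [|t IH] k; first by rewrite mul0n addn0.
  by rewrite mulSn addnA -IH.
have d0 : 0 < j - i by rewrite subn_gt0.
case: (egcdnP p d0) => u v def _.
have co : gcdn (j - i) p = 1.
  apply/eqP; rewrite -/(coprime _ _) coprime_sym prime_coprime //.
  by apply/negP => /(dvdn_leq d0); have := ltn_ord j; lia.
have := cycle_step 0 p0; rewrite (gt u 0) add0n def co.
by rewrite /g modnMDl eqxx.
Qed.

(** A reflection of Z / p, p odd, swaps two consecutive positions.  A walk fixed
    by it would have the same vertex at both, hence a loop. *)
Lemma rot_rev_neq (i j : 'I_p) : odd p -> rot i w != rot j (rev w) :> seq T.
Proof.
move=> op; apply/eqP => eq.
have p0 : 0 < p by case: p op.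
have H k : k < p -> g (k + i) = g (p.*2.-1 - (k + j)).
  move=> kp; have := congr1 (fun s => nth x0 s k) eq.
  rewrite !nth_rot_mod ?size_rev ?size_tuple ?(ltnW (ltn_ord _)) //.
  rewrite nth_rev ?size_tuple ?ltn_mod // /g => ->; congr nth.
  have := ltn_ord j; have := kp; move: (nat_of_ord j) => b ap bp.
  have [ab|ab] := ltnP (k + b) p.
    rewrite [(k + b) %% p]modn_small //.
    have -> : p.*2.-1 - (k + b) = p - (k + b).+1 + p by lia.
    by rewrite modnDr modn_small //; lia.
  have E : (k + b) %% p = k + b - p.
    by rewrite -{1}(subnK ab) modnDr modn_small //; lia.
  by rewrite E modn_small; lia.
have ip := ltn_ord i; have jp := ltn_ord j.
have gp k : g (k + p) = g k by rewrite /g modnDr.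
have clash a : g a = g a.+1 -> False.
  by move/eqP; rewrite (negPf (cycle_step a p0)).
(* Each of the three values of k solves 2 * k + i + j + 2 = 0 modulo p, which
   makes the two positions related by [H] consecutive; the parity of i + j and
   the range k < p impose the case distinction. *)
have [od|ev] := boolP (odd (i + j)); last first.
  pose k := p.-1 - (i + j)./2.
  apply: (clash (k + i)); rewrite H; last by rewrite /k; lia.
  by congr g; rewrite /k; lia.
have [le|lt] := leqP (i + j).+2 p.
  pose k := (p - (i + j).+2)./2.
  apply: (clash (k + i)); rewrite H; last by rewrite /k; lia.
  by rewrite -[RHS]gp; congr g; rewrite /k; lia.
pose k := (3 * p - (i + j).+2)./2.
apply: (clash (k + i)); rewrite H; last by rewrite /k; lia.
by rewrite -gp; congr g; rewrite /k; lia.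
Qed.
End CyclicIndexing.

(** The action is free, so every orbit has as many elements as the group. *)
Lemma card_same_cycle (T : finType) (e : rel T) (p : nat) (w : p.-tuple T) :
  prime p -> odd p -> symmetric e -> irreflexive e -> w \in closed_walks e p ->
  #|[set w' in closed_walks e p | same_cycle w w']| = 2 * p.
Proof.
move=> pp op sym irr; rewrite inE => cyc.
have x0 : T by case: w cyc => [[|x s] //=]; have := prime_gt0 pp; case: (p).
pose f (u : bool * 'I_p) : p.-tuple T :=
  rot_tuple u.2 (if u.1 then rev_tuple w else w).
have -> : [set w' in closed_walks e p | same_cycle w w'] = f @: setT.
  apply/setP => w'; rewrite !inE; apply/andP/imsetP => [[_]|[[b i] _ ->]].
    move/existsP => [i /orP[] /eqP h];
      [exists (false, i) | exists (true, i)] => //; exact: val_inj.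
  split.
    rewrite /= rot_cycle; case: b => //=; rewrite rev_cycle.
    by rewrite (eq_cycle (e' := e)) // => x y; rewrite sym.
  by apply/existsP; exists i; rewrite /=; case: b; rewrite eqxx ?orbT.
rewrite card_imset ?cardsT ?card_prod ?card_bool ?card_ord //.
move=> [b i] [c j] /(congr1 val) /=.
have ij (s : p.-tuple T) : cycle e s -> rot i s = rot j s -> i = j.
  move=> cs eq; apply/eqP; apply: contraT.
  move=> /(rot_neq _ _ _ s x0 irr cs _ _ pp).
  by rewrite eq eqxx.
have crev : cycle e (rev_tuple w).
  by rewrite /= rev_cycle (eq_cycle (e' := e)) // => x y; rewrite sym.
case: b; case: c => /= eq.
- by rewrite (ij _ crev eq).
- by have := rot_rev_neq _ _ _ w x0 irr cyc j i op; rewrite eq eqxx.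
- by have := rot_rev_neq _ _ _ w x0 irr cyc i j op; rewrite eq eqxx.
- by rewrite (ij _ cyc eq).
Qed.

Lemma card_closed_walks (T : finType) (e : rel T) (p : nat) :
  prime p -> odd p -> symmetric e -> irreflexive e ->
  #|closed_walks e p| = num_cycles e p * (2 * p).
Proof.
move=> pp op sym irr; apply: card_uniform_partition.
  by move=> _ /imsetP[w cw ->]; exact: card_same_cycle.
apply: equivalence_partitionP => x y z _ _ _.
exact: same_cycle_equiv (prime_gt0 pp) x y z.
Qed.

Local Open Scope ring_scope.

(** * Traces of powers of the adjacency matrix *)

Lemma card_cons_tuple (T : finType) (k : nat) (P : pred (seq T)) :
  #|[set w : k.+1.-tuple T | P w]| =
  (\sum_x #|[set w : k.-tuple T | P (x :: w)]|)%N.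
Proof.
under [RHS]eq_bigr do rewrite -sum1dep_card.
rewrite -sum1dep_card pair_big_dep /=.
rewrite (reindex (fun u : T * k.-tuple T => cons_tuple u.1 u.2)) //=.
exists (fun w => (thead w, behead_tuple w)) => [[x w] _|w _] /=.
  by congr pair; apply: val_inj.
by apply: val_inj; rewrite /= [in RHS](tuple_eta w).
Qed.

Definition adjmx (R : nzRingType) (T : finType) (e : rel T) : 'M[R]_#|T| :=
  \matrix_(i, j) (e (enum_val i) (enum_val j))%:R.
Arguments adjmx R {T} e.

Lemma adjmx_expE (R : nzRingType) (T : finType) (e : rel T) (k : nat) i j :
  (adjmx R e ^+ k.+1) i j =
  #|[set w : k.-tuple T | path e (enum_val i) (rcons w (enum_val j))]|%:R.
Proof.
elim: k i => [|k IH] i.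
  rewrite expr1 mxE; congr (_%:R).
  have [h|h] := boolP (e _ _).
    rewrite (_ : [set w | _] = setT) ?cardsT ?card_tuple //.
    by apply/setP => w; rewrite !inE tuple0 /= h.
  rewrite (_ : [set w | _] = set0) ?cards0 //.
  by apply/setP => w; rewrite !inE tuple0 /= (negPf h).
rewrite exprS mxE.
rewrite (card_cons_tuple _ _
  (fun s => path e (enum_val i) (rcons s (enum_val j)))).
rewrite natr_sum (big_enum_val (A := T)) /=; apply: eq_bigr => l _.
rewrite IH mxE -natrM; congr (_%:R); case: (e _ _) => /=.
  by rewrite mul1n.
rewrite mul0n; apply/esym/eqP; rewrite cards_eq0 -subset0.
by apply/subsetP => w; rewrite !inE.
Qed.

Lemma trace_adjmx (R : nzRingType) (T : finType) (e : rel T) (p : nat) :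
  (0 < p)%N -> \tr (adjmx R e ^+ p) = #|closed_walks e p|%:R.
Proof.
case: p => // p _; rewrite /closed_walks (card_cons_tuple _ _ (cycle e)).
rewrite natr_sum (big_enum_val (A := T)) /=; apply: eq_bigr => i _.
exact: adjmx_expE.
Qed.

(** Every edge carries two orientations. *)
Lemma card_arcs (T : finType) (e : rel T) : symmetric e -> irreflexive e ->
  #|[set u : T * T | e u.1 u.2]| = (2 * #|edges e|)%N.
Proof.
move=> sym irr; rewrite mulnC -sum_nat_const -sum1_card.
rewrite (partition_big (fun u => [set u.1; u.2]) (mem (edges e))) /=; last first.
  by move=> u; rewrite inE => eu; apply/imsetP; exists u; rewrite ?inE.
apply: eq_bigr => s /imsetP[[a b]]; rewrite inE /= => eab ->{s}.
have ab : a != b by apply/eqP => h; rewrite h irr in eab.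
rewrite sum1dep_card (_ : [set u | _] = [set (a, b); (b, a)]).
  by rewrite cards2 xpair_eqE (negPf ab).
apply/setP => [[x y]]; rewrite !inE /=; apply/andP/orP.
  move=> [exy /eqP eq].
  have xy : x != y by apply/eqP => h; rewrite h irr in exy.
  have : x \in [set a; b] by rewrite -eq !inE eqxx.
  have : y \in [set a; b] by rewrite -eq !inE eqxx orbT.
  rewrite !inE !xpair_eqE => /orP[]/eqP hy /orP[]/eqP hx; subst;
    rewrite ?eqxx in xy *; by auto.
by case=> /eqP[-> ->]; rewrite ?eab ?[e b a]sym ?eab ?eqxx // setUC eqxx.
Qed.

Lemma trace_adjmx1 (R : nzRingType) (T : finType) (e : rel T) :
  irreflexive e -> \tr (adjmx R e) = 0.
Proof. by move=> irr; rewrite /mxtrace big1 // => i _; rewrite mxE irr. Qed.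

Lemma trace_adjmx2 (R : nzRingType) (T : finType) (e : rel T) :
  symmetric e -> irreflexive e -> \tr (adjmx R e ^+ 2) = (2 * #|edges e|)%:R.
Proof.
move=> sym irr; rewrite -card_arcs // -sum1dep_card natr_sum.
transitivity (\sum_(x : T) \sum_(y : T) (e x y)%:R : R).
  rewrite (big_enum_val (A := T)) /=; apply: eq_bigr => i _.
  rewrite expr2 mxE (big_enum_val (A := T)) /=; apply: eq_bigr => j _.
  by rewrite !mxE -natrM [e _ (enum_val i)]sym; case: (e _ _).
rewrite pair_big [RHS]big_mkcond /=; apply: eq_bigr => u _.
by case: (e _ _).
Qed.

(** With J the all-one matrix, A = J - 1 satisfies A ^+ 2 = (m - 1) A + m, whose
    characteristic roots are m and -1; the initial values n = m + 1 and 0 of the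
    trace give the coefficients. *)
Lemma trace_adjmx_complete (R : comNzRingType) (T : finType) (e : rel T)
    (m k : nat) :
  irreflexive e -> complete e -> #|T| = m.+1 ->
  \tr (adjmx R e ^+ k) = m%:R ^+ k + m%:R * (-1) ^+ k.
Proof.
move=> irr com cT.
have sq : adjmx R e ^+ 2 = (m%:R - 1) *: adjmx R e + m%:R%:M.
  have -> : adjmx R e = const_mx 1 - 1%:M.
    apply/matrixP => x y; rewrite !mxE.
    have [->|ne] := eqVneq x y; first by rewrite irr subrr.
    by rewrite com ?subr0 //; apply: contraNneq ne => /enum_val_inj->.
  have JJ : (const_mx 1 : 'M_#|T|) *m const_mx 1 =
      const_mx m.+1%:R :> 'M[R]_#|T|.
    apply/matrixP => x y; rewrite !mxE (eq_bigr (fun=> 1)).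
      by rewrite sumr_const card_ord cT.
    by move=> l _; rewrite !mxE mulr1.
  rewrite expr2 -mulmxE mulmxBl !mulmxBr JJ !mul1mx !mulmx1.
  by apply/matrixP => x y; rewrite !mxE -natr1; case: (x == y) => /=; ring.
elim/ltn_ind: k => [[|[|k]]] IH.
- by rewrite expr0 mxtrace1 cT -natr1; ring.
- by rewrite expr1 trace_adjmx1 //; ring.
rewrite -[in LHS]addn2 exprD sq -mulmxE mulmxDr -scalemxAr mul_mx_scalar.
rewrite mxtraceD !mxtraceZ mulmxE -exprSr !IH //.
by rewrite !exprS; ring.
Qed.

(** * Odd power sums with prescribed first and second power sums *)

(** The error 'X^p - 1 - p * ('X - 1) of the tangent at 1, divided by
    ('X - 1) ^+ 2; the double sum comes from applying the geometric sum formula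
    twice. *)
Definition taylor2 (R : nzRingType) (p : nat) : {poly R} :=
  \sum_(i < p) \sum_(j < i) 'X^j.

Lemma taylor2_poly (R : comNzRingType) (p : nat) :
  'X^p = 1 + p%:R * ('X - 1) + ('X - 1) ^+ 2 * taylor2 R p.
Proof.
have E : \sum_(i < p) 'X ^+ i - p%:R = ('X - 1) * taylor2 R p.
  rewrite mulr_sumr.
  have -> : p%:R = \sum_(i < p) 1 :> {poly R} by rewrite sumr_const card_ord.
  by rewrite -sumrB; apply: eq_bigr => i _; rewrite subrX1.
have /(canRL (subrK _)) -> := subrX1 ('X : {poly R}) p.
by rewrite -(subrK p%:R (\sum_(i < p) 'X ^+ i)) E; ring.
Qed.

Lemma taylor2E (R : comNzRingType) (p : nat) (u : R) :
  u ^+ p = 1 + p%:R * (u - 1) + (u - 1) ^+ 2 * (taylor2 R p).[u].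
Proof.
by rewrite -(hornerXn u) [in LHS]taylor2_poly -polyC_natr !hornerE.
Qed.

(** With Q = taylor2 R p, differentiating the expansion of 'X^p and eliminating
    Q makes (u - 1) ^+ 3 * Q^`().[u] an explicit polynomial in u.  Its quotient
    by u - 1 is the sum of the 1 + u ^+ p.-1 - u ^+ j - u ^+ (p.-1 - j), and
    each of these terms factors: in this form the sign is visible. *)
Lemma deriv_taylor2 (R : idomainType) (p : nat) (u : R) : (0 < p)%N -> u != 1 ->
  (u - 1) ^+ 2 * (taylor2 R p)^`().[u] =
  \sum_(j < p) (1 - u ^+ j) * (1 - u ^+ (p.-1 - j)).
Proof.
case: p => // p _ u1.
have D := congr1 (fun q => q^`().[u]) (taylor2_poly R p.+1).
rewrite /= derivXn -polyC_natr !derivE /= !hornerE in D.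
have u1' : u - 1 != 0 by rewrite subr_eq0.
apply: (mulfI u1').
have -> : \sum_(j < p.+1) (1 - u ^+ j) * (1 - u ^+ (p - j))
   = p.+1%:R * (1 + u ^+ p) - 2 * \sum_(j < p.+1) u ^+ j.
  have -> : 2 * \sum_(j < p.+1) u ^+ j =
       \sum_(j < p.+1) (u ^+ j + u ^+ (p - j)).
    rewrite big_split /= [X in _ + X](reindex_inj rev_ord_inj) /=.
    rewrite mulrDl !mul1r; congr (_ + _); apply: eq_bigr => j _.
    by congr (_ ^+ _); have := ltn_ord j; lia.
  have -> : p.+1%:R * (1 + u ^+ p) = \sum_(j < p.+1) (1 + u ^+ p).
    by rewrite sumr_const card_ord mulr_natl.
  rewrite -sumrB; apply: eq_bigr => j _.
  rewrite -[in X in _ = 1 + u ^+ X - _](subnKC (ltn_ord j : j <= p)%N) exprD.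
  ring.
have G := subrX1 u p.+1; have F := taylor2E _ p.+1 u.
set S := \sum_(j < _) _ in G *.
set Q := (taylor2 _ _).[u] in D F *; set Q' := (_^`()).[u] in D *.
have D' : (u - 1) ^+ 2 * Q' = p.+1%:R * u ^+ p - p.+1%:R - 2 * ((u - 1) * Q).
  by rewrite mulr_natl -[X in X *+ _ - _]hornerXn -hornerMn D /=; ring.
have F' : (u - 1) ^+ 2 * Q = u * u ^+ p - 1 - p.+1%:R * (u - 1).
  by rewrite -exprS F; ring.
transitivity ((u - 1) * (p.+1%:R * u ^+ p - p.+1%:R) - 2 * ((u - 1) ^+ 2 * Q)).
  by rewrite D'; ring.
transitivity (p.+1%:R * (1 + u ^+ p) * (u - 1) - 2 * ((u - 1) * S)); last by ring.
by rewrite F' -G exprS; ring.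
Qed.

Lemma odd_exp_lt1 (R : realDomainType) (k : nat) (u : R) :
  odd k -> (u < 1 -> u ^+ k < 1) /\ (1 < u -> 1 < u ^+ k).
Proof.
move=> ok; have k0 : k != 0%N by case: k ok.
split=> h; last by rewrite exprn_egt1.
have [u0|u0] := leP 0 u; first by rewrite exprn_ilt1.
by apply: lt_trans ltr01; rewrite exprn_odd_lt0.
Qed.

Lemma same_parity_prod_ge0 (R : realDomainType) (a b : nat) (u : R) :
  odd a = odd b -> 0 <= (1 - u ^+ a) * (1 - u ^+ b).
Proof.
move=> ab; have [oa|ea] := boolP (odd a).
  have [a1 a2] := odd_exp_lt1 _ a u oa.
  have [b1 b2] := odd_exp_lt1 _ b u (etrans (esym ab) oa).
  have [u1|u1|->] := ltgtP u 1.
  - by rewrite mulr_ge0 // subr_ge0 ltW ?a1 ?b1.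
  - by rewrite mulr_le0 // subr_le0 ltW ?a2 ?b2.
  - by rewrite expr1n subrr mul0r.
have eb : ~~ odd b by rewrite -ab.
rewrite -[u ^+ a]ger0_norm ?exprn_even_ge0 //.
rewrite -[u ^+ b]ger0_norm ?exprn_even_ge0 //.
rewrite !normrX; have [u1|/ltW u1] := leP `|u| 1.
  by rewrite mulr_ge0 // subr_ge0 exprn_ile1.
by rewrite mulr_le0 // subr_le0 exprn_ege1.
Qed.

(** For odd p the exponents j and p.-1 - j have the same parity, so no
    term of the sum in [deriv_taylor2] is negative.  The term j = 1 has two odd
    exponents and is positive. *)
Lemma deriv_taylor2_gt0 (R : rcfType) (p : nat) (u : R) :
  odd p -> (1 < p)%N -> u != 1 -> 0 < (taylor2 R p)^`().[u].
Proof.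
move=> op p1 u1.
have u2 : 0 < (u - 1) ^+ 2 by rewrite exprn_even_gt0 //= subr_eq0.
rewrite -(pmulr_rgt0 _ u2) deriv_taylor2 //; last exact: ltnW.
have same (j : 'I_p) : odd j = odd (p.-1 - j).
  by have := ltn_ord j; have := op; lia.
rewrite (bigD1 (Ordinal p1)) //= ltr_pwDl //; last first.
  by apply: sumr_ge0 => j _; apply: same_parity_prod_ge0.
rewrite lt_neqAle same_parity_prod_ge0 ?(same (Ordinal p1)) // andbT eq_sym.
rewrite expr1 mulf_neq0 ?subr_eq0 1?eq_sym //.
have [] := odd_exp_lt1 _ (p.-1 - 1) u; first by rewrite -(same (Ordinal p1)).
by have [u1'|u1'|/eqP] := ltgtP u 1; [move=> /(_ isT)/lt_eqF-> _
  | move=> _ /(_ isT)/gt_eqF-> | rewrite (negPf u1)].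
Qed.

(** The sign of the derivative is known only away from 1, so an interval that
    contains 1 is cut there. *)
Lemma taylor2_lt (R : rcfType) (p : nat) (x y : R) :
  odd p -> (1 < p)%N -> x < y -> (taylor2 R p).[x] < (taylor2 R p).[y].
Proof.
move=> op p1 xy.
have mono a b : a < b -> (forall u, a < u < b -> u != 1) ->
    (taylor2 R p).[a] < (taylor2 R p).[b].
  move=> ab n1; have [c] := poly_mvt (taylor2 R p) ab.
  rewrite in_itv /= => cab /(canRL (subrK _)) ->.
  by rewrite ltrDr mulr_gt0 ?subr_gt0 // deriv_taylor2_gt0 ?n1.
have [y1|y1] := leP y 1.
  by apply: mono => // u /andP[_ uy]; rewrite lt_eqF // (lt_le_trans uy).
have [x1|x1] := leP 1 x.
  by apply: mono => // u /andP[xu _]; rewrite gt_eqF // (le_lt_trans x1).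
apply: (@lt_trans _ _ (taylor2 R p).[1]); apply: mono => // u /andP[xu uy].
  by rewrite lt_eqF.
by rewrite gt_eqF.
Qed.

(** As y i <= m for all i, taylor2 R p is at least as large at - y i as at - m.
    The gap between the two sides is the sum of these differences, weighted by
    the (y i + 1) ^+ 2, and it vanishes only if every y i is -1 or m. *)
Lemma power_sum_normalized (R : rcfType) (I : finType) (p m : nat)
    (y : I -> R) :
  #|I| = m.+1 -> odd p -> (1 < p)%N ->
  \sum_i y i = 0 -> \sum_i y i ^+ 2 = m%:R * m.+1%:R ->
  \sum_i y i ^+ p <= m%:R ^+ p - m%:R /\
  (\sum_i y i ^+ p = m%:R ^+ p - m%:R ->
   exists i0, forall i, i != i0 -> y i = -1).
Proof.
move=> cI op p1 s1 s2.
have ym i : y i <= m%:R.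
  have [m0|m0] := posnP m.
    subst m; move: s1; rewrite (bigD1 i) //= big1 ?addr0 => [->//|j].
    have /card_le1_eqP le1 : (#|I| <= 1)%N by rewrite cI.
    by rewrite (le1 i j) ?eqxx.
  (* Cauchy-Schwarz for the other entries, whose mean is - y i / m. *)
  have : 0 <= \sum_(j | j != i) (m%:R * y j + y i) ^+ 2.
    by apply: sumr_ge0 => j _; apply: sqr_ge0.
  have -> : \sum_(j | j != i) (m%:R * y j + y i) ^+ 2 =
      (\sum_j (m%:R * y j + y i) ^+ 2) - (m%:R * y i + y i) ^+ 2.
    by rewrite [in RHS](bigD1 i) //= [RHS]addrC addKr.
  have -> : \sum_j (m%:R * y j + y i) ^+ 2 =
     m%:R ^+ 2 * (\sum_j y j ^+ 2) + 2 * m%:R * y i * (\sum_j y j)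
     + m.+1%:R * y i ^+ 2.
    have -> : m.+1%:R * y i ^+ 2 = \sum_(j : I) y i ^+ 2.
      by rewrite sumr_const cI mulr_natl.
    by rewrite !mulr_sumr -!big_split; apply: eq_bigr => j _ /=; ring.
  rewrite s1 s2 -natr1 => h.
  have {h} : 0 <= (m%:R + 1) * m%:R * (m%:R ^+ 2 - y i ^+ 2) by lra.
  rewrite pmulr_rge0 ?mulr_gt0 ?ltr_wpDl ?ltr0n // subr_ge0 => h.
  have [y0|/ltW y0] := leP 0 (y i); last exact: le_trans y0 (ler0n _ _).
  by rewrite -ler_sqr ?nnegrE.
pose D (i : I) :=
  (y i + 1) ^+ 2 * ((taylor2 R p).[- y i] - (taylor2 R p).[- m%:R]).
have D0 i : 0 <= D i.
  rewrite mulr_ge0 ?sqr_ge0 // subr_ge0.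
  have := ym i; rewrite le_eqVlt => /predU1P[->//|lt].
  by apply/ltW/taylor2_lt => //; rewrite ltrN2.
have oN (x : R) : (- x) ^+ p = - x ^+ p.
  by rewrite exprNn -signr_odd op expr1 mulN1r.
have E : \sum_i D i = m%:R ^+ p - m%:R - \sum_i y i ^+ p.
  pose Q := (taylor2 R p).[- m%:R].
  have A (x : R) : (x + 1) ^+ 2 * (taylor2 R p).[- x] =
      p%:R * (x + 1) - 1 - x ^+ p.
    by rewrite -[x ^+ p]opprK -oN (taylor2E _ p (- x)); ring.
  have B : \sum_i (y i + 1) ^+ 2 = m.+1%:R ^+ 2.
    transitivity (\sum_i y i ^+ 2 + 2 * \sum_i y i + \sum_(i : I) 1).
      by rewrite mulr_sumr -!big_split; apply: eq_bigr => j _ /=; ring.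
    by rewrite s1 s2 sumr_const cI -natr1; ring.
  have C : \sum_i (p%:R * (y i + 1) - 1) = (p%:R - 1) * m.+1%:R.
    transitivity (p%:R * \sum_i y i + (p%:R - 1) * \sum_(i : I) 1).
      by rewrite !mulr_sumr -!big_split; apply: eq_bigr => j _ /=; ring.
    by rewrite s1 sumr_const cI; ring.
  transitivity (\sum_i (p%:R * (y i + 1) - 1) - \sum_i y i ^+ p
      - (\sum_i (y i + 1) ^+ 2) * Q).
    rewrite mulr_suml -!sumrB; apply: eq_bigr => i _.
    by rewrite /D mulrBr A.
  by rewrite B C -natr1 A; ring.
split; first by rewrite -subr_ge0 -E sumr_ge0.
move=> eq; rewrite eq subrr in E.
have y2 i : y i = -1 \/ y i = m%:R.
  have /eqP : D i = 0 by apply: (psumr_eq0P (fun i _ => D0 i) E).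
  rewrite mulf_eq0 expf_eq0 /= addr_eq0 subr_eq0 => /orP[/eqP|/eqP Q].
    by left.
  right; have := ym i; rewrite le_eqVlt => /predU1P[//|lt].
  have := taylor2_lt _ p (- m%:R) (- y i) op p1.
  by rewrite Q ltxx ltrN2 => /(_ lt).
have [i0 /eqP yi0|h] := pickP (fun i => y i == m%:R); last first.
  have y1 i : y i = -1 by case: (y2 i) => // /eqP; rewrite h.
  have : m.+1%:R = 0 :> R.
    move: s1; rewrite (eq_bigr (fun=> -1)) // sumr_const cI => /eqP.
    by rewrite mulNrn oppr_eq0 => /eqP.
  by move/eqP; rewrite pnatr_eq0.
exists i0 => i ne.
(* The numbers y j + 1 are nonnegative and sum to m + 1 = y i0 + 1. *)
have : \sum_(j | j != i0) (y j + 1) = 0.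
  have : \sum_j (y j + 1) = m.+1%:R.
    by rewrite big_split /= s1 add0r sumr_const cI.
  rewrite (bigD1 i0) //= yi0 natr1 => /(canRL (addKr _)).
  by rewrite addrC subrr.
move/psumr_eq0P => /(_ _ i ne) h; apply/eqP; rewrite -subr_eq0 opprK h // => j _.
by case: (y2 j) => ->; rewrite ?addNr // natr1 ler0n.
Qed.

Lemma power_sum_le (R : rcfType) (I : finType) (p m : nat) (s : R)
    (r : I -> R) :
  #|I| = m.+1 -> odd p -> (1 < p)%N -> 0 < s ->
  \sum_i r i = 0 -> \sum_i r i ^+ 2 = s ^+ 2 * (m%:R * m.+1%:R) ->
  \sum_i r i ^+ p <= s ^+ p * (m%:R ^+ p - m%:R) /\
  (\sum_i r i ^+ p = s ^+ p * (m%:R ^+ p - m%:R) ->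
   exists i0, forall i, i != i0 -> r i = - s).
Proof.
move=> cI op p1 s0 s1 s2.
have s0' : s != 0 by rewrite gt_eqF.
have E k : \sum_i (r i / s) ^+ k = (\sum_i r i ^+ k) / s ^+ k.
  by rewrite mulr_suml; apply: eq_bigr => i _; rewrite expr_div_n.
have [||le eq] := power_sum_normalized _ _ p m (fun i => r i / s) cI op p1.
- by rewrite -mulr_suml s1 mul0r.
- by rewrite E s2 mulrC mulKf // expf_neq0.
split; first by rewrite mulrC -ler_pdivrMr ?exprn_gt0 // -E.
move=> h; case: eq => [|i0 hi0].
  by rewrite E h mulrC mulKf // expf_neq0.
by exists i0 => i /hi0 /(canRL (divfK s0')) ->; rewrite mulN1r.
Qed.

(** * The spectrum of a real symmetric matrix *)

(** The second property expresses in terms of entries that A - c has rank at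
    most one, hence vanishing 2 x 2 minors, when at most one eigenvalue differs
    from c.  The diagonalization is carried out over R[i], but neither property
    mentions the eigenvectors, so both descend to R. *)
Lemma real_symmetric_spectrum (R : rcfType) (n : nat) (A : 'M[R]_n) :
  A^T = A ->
  exists r : 'I_n -> R,
    (forall k, \tr (A ^+ k) = \sum_i r i ^+ k) /\
    (forall c i0, (forall i, i != i0 -> r i = c) ->
      forall i j, i != j -> (A i i - c) * (A j j - c) = A i j * A j i).
Proof.
move=> symA.
pose toC := real_complex R : {rmorphism R -> R[i]}.
pose B := map_mx toC A.
have hB : B \is hermsymmx.
  apply: realsym_hermsym.
    apply/is_hermitianmxP. by rewrite expr0 scale1r map_mx_id // map_trmx symA.
  apply/mxOverP => i j; rewrite mxE; apply/complex_realP; by exists (A i j).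
have rB := hermitian_spectral_diag_real hB.
have /orthomx_spectralP EB := hermitian_normalmx hB.
set P := spectralmx B in EB; set d := spectral_diag B in EB rB.
have Pu : P \in unitmx by apply: spectral_unit.
pose r i := complex.Re (d 0 i).
have dr i : d 0 i = toC (r i).
  by rewrite /toC /r /= RRe_real //; apply: (mxOverP rB).
exists r; split.
  move=> k; apply: (@complexI R).
  rewrite -[LHS]/(toC _) -[RHS]/(toC _) -trace_map_mx.
  have -> : map_mx toC (A ^+ k) = invmx P *m diag_mx (\row_l d 0 l ^+ k) *m P.
    elim: k => [|k IH].
      rewrite expr0 map_mx1 (_ : diag_mx _ = 1%:M) ?mulmx1 ?mulVmx //.
      by apply/matrixP => x y; rewrite !mxE expr0.
    rewrite exprS -mulmxE map_mxM -/B IH {1}EB -!mulmxA mulKVmx // !mulmxA.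
    rewrite -[X in X *m P]mulmxA mulmx_diag; congr (_ *m diag_mx _ *m _).
    by apply/rowP => l; rewrite !mxE exprS.
  rewrite mxtrace_mulC mulKVmx // mxtrace_diag rmorph_sum.
  by apply: eq_bigr => l _; rewrite mxE dr rmorphXn.
move=> c i0 rc i j ij.
have E x y : B x y - toC c * (x == y)%:R =
   (toC (r i0) - toC c) * (invmx P x i0 * P i0 y).
  have -> : (x == y)%:R = (invmx P *m P) x y by rewrite mulVmx // mxE.
  rewrite {1}EB mul_mx_diag !mxE mulr_sumr -sumrB (bigD1 i0) //= big1 ?addr0.
    by rewrite !mxE dr; ring.
  by move=> l /rc rl; rewrite !mxE dr rl; ring.
apply: (@complexI R).
rewrite -[LHS]/(toC _) -[RHS]/(toC _) !rmorphM !rmorphB /=.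
have Bij x y : toC (A x y) = B x y by rewrite mxE.
rewrite !Bij.
have := E i i; have := E j j; have := E i j; have := E j i.
rewrite !eqxx [j == i]eq_sym (negPf ij) /= !mulr0 !mulr1 !subr0 => -> -> -> ->.
ring.
Qed.

(** * The bound on the number of cycles *)

(** The bound is the value of the p-th power sum at (s * m, - s, ..., - s),
    divided by the order 2 * p of the dihedral group. *)
Lemma cycle_bound_trace (R : realType) (p m E : nat) (s : R) :
  (0 < p)%N -> (0 < m)%N -> (0 < E)%N -> 0 < s ->
  s ^+ 2 * (m%:R * m.+1%:R) = (2 * E)%:R ->
  cycle_bound R p m.+1 E * (2 * p)%:R = s ^+ p * (m%:R ^+ p - m%:R).
Proof.
move=> p0 m0 E0 s0 defs.
have m0' : 0 < m%:R :> R by rewrite ltr0n.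
have n0' : 0 < m.+1%:R :> R by rewrite ltr0n.
have E0' : 0 < E%:R :> R by rewrite ltr0n.
have p0' : 0 < p%:R :> R by rewrite ltr0n.
set h : R := p%:R / 2.
have h0 : 0 < h by rewrite divr_gt0.
have split_pow : 2 `^ h * E%:R `^ h = s ^+ p * (m%:R `^ h * m.+1%:R `^ h).
  have -> : s ^+ p = (s ^+ 2) `^ h.
    rewrite -!powR_mulrn ?(ltW s0) // -powRrM.
    by rewrite mulrCA divff ?mulr1 ?pnatr_eq0.
  rewrite -!powRM ?sqr_ge0 ?mulr_ge0 ?ler0n //.
  by rewrite defs natrM.
have mB := mulr_powRB1 (ltW m0') h0.
have tB := mulr_powRB1 (ler0n R 2) h0.
rewrite -tB -mB in split_pow; rewrite /cycle_bound -/h.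
have -> : m.+1%:R - 1 = m%:R :> R by rewrite -natr1 addrK.
have mp : m%:R ^+ p = m%:R * m%:R ^+ (p - 1) :> R by rewrite -exprS subn1 prednK.
rewrite mp natrM.
have X0 : m.+1%:R `^ h != 0 by rewrite gt_eqF ?powR_gt0.
have Y0 : m%:R `^ (h - 1) != 0 by rewrite gt_eqF ?powR_gt0.
set X := m.+1%:R `^ h in split_pow X0 *.
set Y := m%:R `^ (h - 1) in split_pow Y0 *.
set Z := 2 `^ (h - 1) in split_pow *.
set W := E%:R `^ h in split_pow *.
have -> : (m%:R ^+ (p - 1) - 1) / (X * Y) * (Z / p%:R) * W * (2 * p%:R)
   = (m%:R ^+ (p - 1) - 1) / (X * Y) * (2 * Z * W).
  by field; rewrite X0 Y0 gt_eqF.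
rewrite split_pow; field; by rewrite X0 Y0.
Qed.

Theorem theorem4 (R : realType) (p : nat) (T : finType) (e : rel T) :
  prime p -> odd p -> symmetric e -> irreflexive e ->
  ((num_cycles e p)%:R <= cycle_bound R p #|T| #|edges e|)
  /\ ((0 < #|edges e|)%N ->
      ((num_cycles e p)%:R = cycle_bound R p #|T| #|edges e| <-> complete e)).
Proof.
move=> pp op sym irr.
have p1 := prime_gt1 pp; have p0 := prime_gt0 pp.
have tr_p : (num_cycles e p)%:R * (2 * p)%:R = \tr (adjmx R e ^+ p).
  by rewrite trace_adjmx // (card_closed_walks _ _ _ pp op sym irr) [RHS]natrM.
have dp0 : 0 < (2 * p)%:R :> R by rewrite ltr0n muln_gt0.
have edge_mem x y : e x y -> [set x; y] \in edges e.
  by move=> exy; apply/imsetP; exists (x, y); rewrite ?inE.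
have [E0|E0] := posnP #|edges e|.
  (* Without edges s would be 0 and the scaling impossible. *)
  split=> //; rewrite E0 /cycle_bound powR0 ?mulr0; last first.
    by rewrite mulf_neq0 ?invr_eq0 // pnatr_eq0 // -lt0n.
  have A0 : adjmx R e = 0.
    apply/matrixP => i j; rewrite !mxE.
    case: (boolP (e _ _)) => // /edge_mem.
    by move/eqP: E0; rewrite cards_eq0 => /eqP ->; rewrite inE.
  rewrite -(pmulr_lle0 _ dp0) tr_p A0 -(prednK p0) exprS mul0r.
  by rewrite mxtrace0.
have [m m0 cT] : exists2 m, (0 < m)%N & #|T| = m.+1.
  have [u] : exists u, u \in edges e by apply/card_gt0P.
  case/imsetP => -[x y]; rewrite inE /= => exy _.
  have : (1 < #|T|)%N.
    apply/card_gt1P; exists x, y; split => //.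
    by apply/eqP => xy; rewrite xy irr in exy.
  by case: #|T| => [|[|m]] // _; exists m.+1.
pose c : R := m%:R * m.+1%:R.
have c0 : 0 < c by rewrite mulr_gt0 ?ltr0n.
pose s := Num.sqrt ((2 * #|edges e|)%:R / c).
have s0 : 0 < s by rewrite sqrtr_gt0 divr_gt0 ?ltr0n ?muln_gt0.
have s2 : s ^+ 2 * c = (2 * #|edges e|)%:R.
  by rewrite sqr_sqrtr ?divfK ?gt_eqF // divr_ge0 ?ler0n ?ltW.
have bound := cycle_bound_trace _ _ _ _ _ p0 m0 E0 s0 s2.
have symA : (adjmx R e)^T = adjmx R e.
  by apply/matrixP => i j; rewrite !mxE sym.
have [r [tr_r minor]] := real_symmetric_spectrum _ _ _ symA.
have [|||le eq] := power_sum_le _ _ p m s r _ op p1 s0.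
- by rewrite card_ord.
- rewrite -[RHS](trace_adjmx1 R _ _ irr) -[adjmx R e]expr1 tr_r.
  by apply: eq_bigr => i _; rewrite expr1.
- by rewrite -tr_r trace_adjmx2 // s2.
rewrite cT; split.
  by rewrite -(ler_pM2r dp0) tr_p bound tr_r.
move=> _; split=> [ext|com].
  case: eq => [|i0 hi0]; first by rewrite -tr_r -tr_p ext bound.
  move=> x y xy; apply: contraT => nexy.
  have := minor _ _ hi0 (enum_rank x) (enum_rank y).
  rewrite !mxE !enum_rankK !irr (negPf nexy) (inj_eq enum_rank_inj) => /(_ xy).
  by rewrite mul0r sub0r opprK => /eqP; rewrite mulf_eq0 gt_eqF.
apply: (mulIf (lt0r_neq0 dp0)); rewrite tr_p bound.
have tr_c k := trace_adjmx_complete R _ _ _ k irr com cT.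
(* The complete graph has 2 * E = m * (m + 1). *)
have s1 : s = 1.
  apply/eqP; rewrite -(@eqrXn2 _ 2) ?ltW // expr1n; apply/eqP.
  apply: (mulIf (lt0r_neq0 c0)); rewrite s2 -trace_adjmx2 // tr_c /c -natr1.
  by rewrite sqrrN expr1n; ring.
by rewrite tr_c s1 expr1n mul1r -signr_odd op expr1 mulrN1.
Qed.
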